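(* Let $(X,\mathcal U)$ be a quasi-uniform space whose quasi-uniformity is generated by an $F$-quasi-gauge $D$ (i.e. $\mathcal U=\mathcal U_D$), and let $f:X\to\mathbb R\cup\{\infty\}$. Suppose that $(X,\mathcal U)$ is sequentially right $K$-complete, the topology $\tau(\mathcal U)$ is $T_1$, $f$ is proper and bounded below, and for every $x\in X$ the set $$S_f(x)=\{y\in X: f(y)+d(y,x)\le f(x)\ \text{ for all } d\in D\}$$ is sequentially $\mathcal U$-closed. If for every $x\in X$ with $f(x)>\inf f(X)$ there exists $y\in X\setminus\{x\}$ such that $$f(y)+d(y,x)\le f(x)\quad\text{for all } d\in D,$$ then there exists $z\in X$ with $f(z)=\inf f(X)$.
   Context: A quasi-uniformity on a set $X$ is a nonempty family $\mathcal U$ of subsets of $X\times X$ which contain the diagonal, closed under supersets and finite intersections, such that for every $U\in\mathcal U$ there is $V\in\mathcal U$ with $V\circ V\subseteq U$, where $M\circ N=\{(x,z):\exists y,\ (x,y)\in M,\ (y,z)\in N\}$. The topology $\tau(\mathcal U)$ has $\{U(x):U\in\mathcal U\}$, $U(x)=\{y\in X:(x,y)\in U\}$, as neighborhood basis at $x$. An $F$-quasi-gauge on $X$ is a family $D$ of functions $d:X\times X\to\mathbb R$ such that: (QF1) $D$ is directed upward (for the pointwise order); (QF2) $d(x,y)\ge 0$ and $d(x,x)=0$ for all $d\in D$, $x,y\in X$; (QF3) for every $d\in D$ there is $d'\in D$ with $d'\ge d$ such that $d(x,y)\le d'(x,z)+d'(z,y)$ for all $x,y,z\in X$. It generates the quasi-uniformity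 $\mathcal U_D$ having as basis the sets $V_{d,\varepsilon}=\{(x,y)\in X\times X: d(x,y)<\varepsilon\}$, $d\in D$, $\varepsilon>0$. A sequence $(x_n)$ is right $K$-Cauchy if for every $U\in\mathcal U$ there is $n_U\in\mathbb N$ such that $(x_{n+k},x_n)\in U$ for all $n\ge n_U$ and all $k\in\mathbb N$. $(X,\mathcal U)$ is sequentially right $K$-complete if every right $K$-Cauchy sequence is $\tau(\mathcal U)$-convergent to some point of $X$. A set is sequentially $\mathcal U$-closed if it contains every $\tau(\mathcal U)$-limit of every sequence of its elements. $f$ is proper if $\{x: f(x)<\infty\}\neq\emptyset$. *)

(* Defs.v *)
From HB Require Import structures.
From mathcomp Require Import all_boot all_order all_algebra.
From mathcomp Require Import all_classical all_reals all_analysis.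

Set Implicit Arguments.
Unset Strict Implicit.
Unset Printing Implicit Defensive.

Import Order.TTheory GRing.Theory Num.Theory.
Import numFieldNormedType.Exports.

Local Open Scope classical_set_scope.
Local Open Scope ring_scope.

Record quasiUniformity (X : Type) := QuasiUniformity {
  qentourage :> set_system (X * X);
  qentourage_nonempty : qentourage !=set0;
  qentourage_diagonal : forall U, qentourage U -> diagonal `<=` U;
  qentourage_superset : forall U V, U `<=` V -> qentourage U -> qentourage V;
  qentourageI : forall U V, qentourage U -> qentourage V -> qentourage (U `&` V);
  qentourage_split : forall U, qentourage U ->
    exists2 V, qentourage V & (V \; V)%relation `<=` U
}.

(* [qspace U] is X carrying the topology tau(U); [nbhs_] is the library's
   neighborhood system generated by the sections U(x) = [set y | (x, y) \in U]. *)
Definition qspace (X : Type) (U : quasiUniformity X) : Type := {classic X}.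

Section QSpaceTopology.
Variables (X : Type) (U : quasiUniformity X).

HB.instance Definition _ := Choice.on (qspace U).
HB.instance Definition _ := hasNbhs.Build (qspace U) (nbhs_ (qentourage U)).

Let nbhs_filter (p : qspace U) : ProperFilter (nbhs p).
Proof.
apply: filter_from_proper; last first.
  by move=> A entA; exists p; apply/mem_set; apply: qentourage_diagonal entA _ _.
apply: filter_from_filter.
  by have [A entA] := qentourage_nonempty U; exists A.
move=> A B entA entB; exists (A `&` B); last by rewrite xsectionI.
exact: qentourageI.
Qed.

Let nbhs_singleton (p : qspace U) (A : set (qspace U)) : nbhs p A -> A p.
Proof.
move=> [B entB sBpA].
by apply/sBpA/mem_set; exact: qentourage_diagonal entB _ _.
Qed.

Let nbhs_nbhs (p : qspace U) (A : set (qspace U)) :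
  nbhs p A -> nbhs p (nbhs^~ A).
Proof.
move=> [B entB sBpA]; have [C entC sC2B] := qentourage_split entB.
exists C => // q Cpq; exists C => // r Cqr.
by apply/sBpA/mem_set/sC2B; exists q; exact/set_mem.
Qed.

HB.instance Definition _ := Nbhs_isNbhsTopological.Build (qspace U)
  nbhs_filter nbhs_singleton nbhs_nbhs.

End QSpaceTopology.

(* No nonemptiness of D is required here: a quasi-uniformity is nonempty, so
   [qentourage U = gauge_entourage D] already excludes the empty family. *)
Record F_quasi_gauge (R : realType) (X : Type) (D : set (X -> X -> R)) : Prop := {
  gauge_directed : forall d1 d2, D d1 -> D d2 -> exists2 d, D d &
    forall x y, d1 x y <= d x y /\ d2 x y <= d x y;
  gauge_ge0 : forall d, D d -> forall x y, 0 <= d x y;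
  gauge_diag : forall d, D d -> forall x, d x x = 0;
  gauge_triangle : forall d, D d -> exists d', [/\ D d',
    (forall x y, d x y <= d' x y) &
    forall x y z, d x y <= d' x z + d' z y]
}.

Definition gauge_entourage (R : realType) (X : Type) (D : set (X -> X -> R)) :
    set_system (X * X) :=
  filter_from [set de : (X -> X -> R) * R | D de.1 /\ 0 < de.2]
    (fun de => [set xy | de.1 xy.1 xy.2 < de.2]).

Definition right_K_cauchy (X : Type) (U : quasiUniformity X) (x : nat -> X) :=
  forall V, qentourage U V ->
    exists N : nat, forall n k : nat, (N <= n)%N -> V (x (n + k)%N, x n).

Definition seq_right_K_complete (X : Type) (U : quasiUniformity X) :=
  forall x : nat -> qspace U, right_K_cauchy U x ->
    exists l : qspace U, x @ \oo --> l.

Definition seq_closed (X : Type) (U : quasiUniformity X) (A : set (qspace U)) :=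
  forall (x : nat -> qspace U) (l : qspace U),
    (forall n, A (x n)) -> x @ \oo --> l -> A l.

Definition S_set (R : realType) (X : Type) (D : set (X -> X -> R))
    (f : X -> \bar R) (x : X) : set X :=
  [set y | forall d, D d -> (f y + (d y x)%:E <= f x)%E].

(* Main.v *)
Require Import Defs.
From HB Require Import structures.
From mathcomp Require Import all_boot all_order all_algebra.
From mathcomp Require Import all_classical all_reals all_analysis.

Set Implicit Arguments.
Unset Strict Implicit.
Unset Printing Implicit Defensive.

Import Order.TTheory GRing.Theory Num.Theory.
Import numFieldNormedType.Exports.

Local Open Scope classical_set_scope.
Local Open Scope ring_scope.
Local Open Scope ereal_scope.

(** Write S(x) for the set of the statement; the relation y \in S(x) is a
preorder on X for which f is nonincreasing along passages to S(x), and the last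
hypothesis says that a point x with f(x) > inf f has a successor other than x.
So it is enough to find a point z of finite value with S(z) = {z}.

To find it, start at a point of finite value and choose x_{n+1} in S(x_n) with
f(x_{n+1}) <= inf f(S(x_n)) + 1/(n+1); this uses that f is bounded below
([exists_almost_min]). Since the sets S(x_n) decrease, every y in S(x_{n+1})
satisfies f(x_{n+1}) - f(y) <= 1/(n+1), hence d(y, x_{n+1}) <= 1/(n+1) for all
gauges d at once ([almost_min_gauge_le]). In particular (x_n) is right
K-Cauchy. A limit z belongs to every S(x_n), by closedness applied to the tails
of the sequence. If y is in S(z), then y is in every S(x_n) as well, and
f(z) <= f(x_{n+1}) <= f(y) + 1/(n+1) for all n, so f(z) <= f(y); together with
f(y) + d(y, z) <= f(z) this forces d(y, z) = 0 for every d. Then z is in every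
neighborhood of y, and the T1 axiom gives y = z ([T1_gauge_separated]). *)

Lemma exists_almost_min (R : realType) (X : Type) (f : X -> \bar R)
    (A : set X) (m e : R) :
  (forall x, m%:E <= f x) -> A !=set0 -> (0 < e)%R ->
  exists2 y, A y & forall z, A z -> f y <= f z + e%:E.
Proof.
move=> mf [a Aa] e0.
have ge_m : m%:E <= ereal_inf (f @` A).
  by apply: le_ereal_inf_tmp => _ [x _ <-]; exact: mf.
have inf_le z : A z -> ereal_inf (f @` A) <= f z.
  by move=> Az; apply: ereal_inf_lbound; exists z.
have [fin|] := boolP (ereal_inf (f @` A) \is a fin_num).
  have [_ [y Ay <-] /ltW le_y] := lb_ereal_inf_adherent e0 fin.
  by exists y => // z Az; apply: (le_trans le_y); rewrite leeD2r // inf_le.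
(* An infinite infimum is +oo, and then every point is an almost minimum. *)
case: (ereal_inf _) ge_m inf_le => [r||] // _ inf_le _.
by exists a => // z /inf_le; rewrite leye_eq => /eqP ->; rewrite leey.
Qed.

Section Successors.
Variables (R : realType) (X : Type) (D : set (X -> X -> R)) (f : X -> \bar R).
Hypothesis gaugeD : F_quasi_gauge D.

Lemma S_set_refl x : S_set D f x x.
Proof. by move=> d Dd; rewrite (gauge_diag gaugeD Dd) adde0. Qed.

(** The triangle inequality of an F-quasi-gauge bounds d by a larger member d'
of D; this does no harm because S(x) involves all members of D. *)
Lemma S_set_trans x y z : S_set D f x y -> S_set D f y z -> S_set D f x z.
Proof.
move=> Sxy Syz d Dd; have [d' [Dd' _ tri]] := gauge_triangle gaugeD Dd.
apply: le_trans (Sxy _ Dd'); apply: le_trans (leeD2r _ (Syz _ Dd')).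
by rewrite -addeA -EFinD leeD2l // lee_fin.
Qed.

Hypothesis D0 : D !=set0.

Lemma S_set_le x y : S_set D f x y -> f y <= f x.
Proof.
move=> Sxy; have [d Dd] := D0; apply: le_trans (Sxy _ Dd).
by rewrite leeDl // lee_fin (gauge_ge0 gaugeD).
Qed.

Variable m : R.
Hypothesis f_ge : forall x, m%:E <= f x.

Lemma S_set_fin_num x y : f x < +oo -> S_set D f x y -> f y \is a fin_num.
Proof.
move=> fx /S_set_le yx; rewrite fin_numE -ltNye -ltey.
by rewrite (lt_le_trans (ltNyr m) (f_ge y)) (le_lt_trans yx fx).
Qed.

(** What ties the gauges to f: a successor y of x pays for its gauge distance
to x with a decrease of f. The bound e does not depend on d, so it controls
all gauges at once. *)
Lemma almost_min_gauge_le x y d (e : R) : f x < +oo -> D d ->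
  S_set D f x y -> f x <= f y + e%:E -> (d y x <= e)%R.
Proof.
move=> fx Dd Sxy xy; have fin_y := S_set_fin_num fx Sxy.
by have := le_trans (Sxy _ Dd) xy; rewrite leeD2lE // lee_fin.
Qed.

(** The accuracy must tend to 0, as the infima of f over the decreasing sets
S(x_n) are then approached both by f(x_{n+1}) and by f at any common
successor. *)
Lemma S_set_minimizing_seq x0 : exists x : nat -> X,
  [/\ x 0%N = x0, forall n, S_set D f (x n) (x n.+1) &
      forall n y, S_set D f (x n) y -> f (x n.+1) <= f y + (n.+1%:R^-1)%:E].
Proof.
have /choice [next nextP] (p : nat * X) : exists y, S_set D f p.2 y /\
    forall z, S_set D f p.2 z -> f y <= f z + (p.1.+1%:R^-1)%:E.
  have e0 : (0 < p.1.+1%:R^-1 :> R)%R by rewrite invr_gt0 ltr0n.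
  have Sp0 : S_set D f p.2 !=set0 by exists p.2; exact: S_set_refl.
  by have [y Sy ymin] := exists_almost_min f_ge Sp0 e0; exists y.
pose x := fix x n := if n is k.+1 then next (k, x k) else x0.
by exists x; split=> // n; have [] := nextP (n, x n).
Qed.

End Successors.

Section GaugeTopology.
Variables (R : realType) (X : Type) (U : quasiUniformity X).
Variable D : set (X -> X -> R).
Hypothesis genU : qentourage U = gauge_entourage D.

Lemma gauge_nonempty : D !=set0.
Proof.
by have [V] := qentourage_nonempty U; rewrite genU => -[[d e] [Dd _] _]; exists d.
Qed.

(** If d(y, z) = 0 for all d, then z lies in every neighborhood of y. *)
Lemma T1_gauge_separated : accessible_space (qspace U) ->
  forall y z : X, (forall d, D d -> (d y z <= 0)%R) -> y = z.
Proof.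
move=> T1 y z dyz; apply: contrapT => yz.
have neq_yz : (y : qspace U) != z by apply/eqP.
have [A [openA /set_mem Ay /set_mem]] := T1 _ _ neq_yz; apply.
have [V entV sVA] : nbhs (y : qspace U) A by exact: open_nbhs_nbhs.
apply/sVA/mem_set; move: entV; rewrite genU => -[[d e] [Dd e0]]; apply.
exact: le_lt_trans (dyz d Dd) e0.
Qed.

(** The index is shifted by one because x_0 is arbitrary: it is x_{n+1} that is
chosen with accuracy 1/(n+1). *)
Lemma right_K_cauchy_inv_nat (x : nat -> X) :
  (forall d, D d -> forall n k,
     (d (x (n.+1 + k)%N) (x n.+1) <= n.+1%:R^-1)%R) ->
  right_K_cauchy U x.
Proof.
move=> dx V; rewrite genU => -[[d e] [Dd /= e0] sV].
have [N _ Ne] := near_infty_natSinv_lt (PosNum e0).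
exists N.+1 => -[//|n] k Nn; apply: sV => /=.
exact: le_lt_trans (dx _ Dd _ _) (Ne _ Nn).
Qed.

End GaugeTopology.

(** A form of Ekeland's variational principle: the successor preorder has a
minimal point of finite value. *)
Lemma exists_S_set_minimal (R : realType) (X : Type) (U : quasiUniformity X)
    (D : set (X -> X -> R)) (f : X -> \bar R) (m : R) :
  F_quasi_gauge D -> qentourage U = gauge_entourage D ->
  seq_right_K_complete U -> accessible_space (qspace U) ->
  (exists x, f x < +oo) -> (forall x, m%:E <= f x) ->
  (forall x, @seq_closed X U (S_set D f x)) ->
  exists2 z, f z < +oo & forall y, S_set D f z y -> y = z.
Proof.
move=> gaugeD genU completeU T1 [x0 fx0] f_ge S_closed.
have D0 := gauge_nonempty genU.
have [x [x0E Sx xmin]] := S_set_minimizing_seq gaugeD f_ge x0.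
have Sxk n k : S_set D f (x n) (x (n + k)%N).
  elim: k => [|k IHk]; first by rewrite addn0; exact: S_set_refl.
  by rewrite addnS; exact: (S_set_trans gaugeD IHk).
have fx n : f (x n) < +oo.
  by apply: le_lt_trans fx0; rewrite -x0E; exact: (S_set_le gaugeD D0 (Sxk 0%N n)).
have cauchy : right_K_cauchy U x.
  apply: (right_K_cauchy_inv_nat genU) => d Dd n k.
  apply: (almost_min_gauge_le gaugeD D0 f_ge (fx _) Dd (Sxk _ _)).
  by apply: xmin; rewrite addSnnS; exact: Sxk.
have [z xz] := completeU x cauchy.
have Sxz n : S_set D f (x n) z.
  apply: (S_closed (x n) (fun k => x (n + k)%N)) => [k|]; first exact: Sxk.
  apply: cvg_comp xz; exact: cvg_addnl.
have fz : f z < +oo by exact: le_lt_trans (S_set_le gaugeD D0 (Sxz 0%N)) (fx 0%N).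
exists z => // y Szy; apply: (T1_gauge_separated genU T1) => d Dd.
apply: (almost_min_gauge_le gaugeD D0 f_ge fz Dd Szy); rewrite adde0.
apply/lee_addgt0Pr => e e0.
have [N _ Ne] := near_infty_natSinv_lt (PosNum e0).
apply: (le_trans (S_set_le gaugeD D0 (Sxz N.+1))).
apply: (le_trans (xmin N y (S_set_trans gaugeD (Sxz N) Szy))).
by rewrite leeD2l // lee_fin ltW //; exact: (Ne N (leqnn N)).
Qed.

Theorem theorem4p14 (R : realType) (X : Type) (U : quasiUniformity X)
    (D : set (X -> X -> R)) (f : X -> \bar R)
    (gaugeD : F_quasi_gauge D)
    (genU : qentourage U = gauge_entourage D)
    (f_neq_ninfty : forall x, f x != -oo)
    (completeU : seq_right_K_complete U)
    (T1 : accessible_space (qspace U))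
    (f_proper : exists x, f x < +oo)
    (f_bounded_below : exists m : R, forall x, m%:E <= f x)
    (S_closed : forall x, @seq_closed X U (S_set D f x))
    (improve : forall x, ereal_inf (range f) < f x ->
       exists y, y <> x /\ forall d, D d -> f y + (d y x)%:E <= f x) :
  exists z, f z = ereal_inf (range f).
Proof.
have [m f_ge] := f_bounded_below.
have [z _ zmin] :=
  exists_S_set_minimal gaugeD genU completeU T1 f_proper f_ge S_closed.
exists z; apply/eqP; rewrite eq_le ereal_inf_lbound ?andbT; last by exists z.
rewrite leNgt; apply/negP => /improve[y [yz Szy]].
exact/yz/zmin.
Qed.
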